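(* Let $p$ be an odd prime, let $G$ be the dihedral group of order $2p$ acting on $F[V]$ as described in the context, and let $\mathcal{G}\subseteq F[V]$ be the set consisting of the following polynomials: - $m+\sigma(m)$ for $m\in M^\rho\setminus M^G$ of degree at most $p$; - $um$ for $m\in M^\rho$ of degree at most $p$ and $u$ a variable dividing $m$; - $x_iy_i$ for $i=1,\ldots,r$ and $z_jw_j$ for $j=1,\ldots,s$. Then $\mathcal{G}$ forms a universal Gröbner basis of the Hilbert ideal $I_H$, i.e. $\mathcal{G}$ is a Gröbner basis of $I_H$ with respect to every monomial order on $F[V]$.
   Context: Let $p$ be an odd prime and let $G=D_{2p}$ be the dihedral group of order $2p$, generated by an element $\sigma$ of order $2$ and an element $\rho$ of order $p$. Let $F$ be a field of characteristic two containing a primitive $p$th root of unity. $G$ acts by graded $F$-algebra automorphisms on the polynomial ring $F[V]=F[x_1,\ldots,x_r,y_1,\ldots,y_r,z_1,\ldots,z_s,w_1,\ldots,w_s]$ (with $r,s\ge 0$) as follows: $\sigma$ interchanges $x_i$ and $y_i$ for $i=1,\ldots,r$ and interchanges $z_i$ and $w_i$ for $i=1,\ldots,s$; $\rho$ fixes all $z_i$ and $w_i$, while $\rho(x_i)=\lambda_i x_i$ and $\rho(y_i)=\lambda_i^{-1}y_i$, where $\lambda_i\in F$ is a nontrivial $p$-th root of unity ($\lambda_i^p=1$, $\lambda_i\ne 1$) for $i=1,\ldots,r$. ''Variable'' means one of the $x_i,y_i,z_i,w_i$. $M$ denotes the set of monomials of $F[V]$, $M^\rho$ the set of $\rho$-invariant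 monomials, and $M^G$ the set of $G$-invariant monomials. The Hilbert ideal $I_H$ is the ideal of $F[V]$ generated by all $G$-invariant polynomials of positive degree. *)

(* Defs.v *)
From HB Require Import structures.
From mathcomp Require Import all_boot all_order all_algebra all_fingroup all_solvable.
From mathcomp Require Import mpoly.

Set Implicit Arguments.
Unset Strict Implicit.
Unset Printing Implicit Defensive.

Import GRing.Theory.
Local Open Scope ring_scope.

Definition in_ideal (R : comNzRingType) (S : R -> Prop) (f : R) : Prop :=
  exists (k : nat) (a g : 'I_k -> R),
    (forall i, S (g i)) /\ f = \sum_(i < k) a i * g i.

Definition monomial_order (n : nat) (le : rel 'X_{1..n}) : Prop :=
  [/\ reflexive le, antisymmetric le, transitive le & total le] /\
  (forall m, le 0%MM m) /\
  (forall m1 m2 m, le m1 m2 -> le (m1 + m)%MM (m2 + m)%MM).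

Definition is_leading (F : fieldType) (n : nat) (le : rel 'X_{1..n})
    (f : {mpoly F[n]}) (m : 'X_{1..n}) : Prop :=
  m \in msupp f /\ (forall m', m' \in msupp f -> le m' m).

Definition leading_ideal (F : fieldType) (n : nat) (le : rel 'X_{1..n})
    (S : {mpoly F[n]} -> Prop) : {mpoly F[n]} -> Prop :=
  in_ideal (fun h => exists f m, [/\ S f, is_leading le f m & h = 'X_[m]]).

Definition groebner_basis (F : fieldType) (n : nat) (le : rel 'X_{1..n})
    (I S : {mpoly F[n]} -> Prop) : Prop :=
  [/\ exists s : seq {mpoly F[n]}, forall f, S f <-> f \in s,
      forall f, S f -> I f
    & forall f, leading_ideal le S f <-> leading_ideal le I f].

Definition universal_groebner_basis (F : fieldType) (n : nat)
    (I S : {mpoly F[n]} -> Prop) : Prop :=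
  forall le : rel 'X_{1..n}, monomial_order le -> groebner_basis le I S.

(* The variables come in four blocks x, y, z, w of sizes r, r, s, s. *)
Definition nvars (r s : nat) : nat := ((r + r) + (s + s))%N.

Definition ix (r s : nat) (i : 'I_r) : 'I_(nvars r s) :=
  lshift (s + s) (lshift r i).
Definition iy (r s : nat) (i : 'I_r) : 'I_(nvars r s) :=
  lshift (s + s) (rshift r i).
Definition iz (r s : nat) (j : 'I_s) : 'I_(nvars r s) :=
  rshift (r + r) (lshift s j).
Definition iw (r s : nat) (j : 'I_s) : 'I_(nvars r s) :=
  rshift (r + r) (rshift s j).
Arguments ix {r} s i.
Arguments iy {r} s i.
Arguments iz r {s} j.
Arguments iw r {s} j.

Definition graded_action (gT : finGroupType) (F : fieldType) (n : nat)
    (act : gT -> {lrmorphism {mpoly F[n]} -> {mpoly F[n]}}) : Prop :=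
  [/\ forall f, act 1%g f = f,
      forall g h f, act (g * h)%g f = act g (act h f)
    & forall g d f, f \is d.-homog -> act g f \is d.-homog].

Definition dihedral_on_variables (gT : finGroupType) (F : fieldType)
    (r s : nat) (lambda : 'I_r -> F) (sigma rho : gT)
    (act : gT -> {lrmorphism {mpoly F[nvars r s]} -> {mpoly F[nvars r s]}})
    : Prop :=
  [/\ forall i, act sigma 'X_(ix s i) = 'X_(iy s i) /\
                act sigma 'X_(iy s i) = 'X_(ix s i),
      forall j, act sigma 'X_(iz r j) = 'X_(iw r j) /\
                act sigma 'X_(iw r j) = 'X_(iz r j),
      forall i, act rho 'X_(ix s i) = lambda i *: 'X_(ix s i) /\
                act rho 'X_(iy s i) = (lambda i)^-1 *: 'X_(iy s i)
    & forall j, act rho 'X_(iz r j) = 'X_(iz r j) /\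
                act rho 'X_(iw r j) = 'X_(iw r j)].

(* Positive degree is taken homogeneously: allowing an invariant such as
   1 + z * w next to z * w would put 1 in the ideal. *)
Definition hilbert_ideal (gT : finGroupType) (F : fieldType) (n : nat)
    (act : gT -> {lrmorphism {mpoly F[n]} -> {mpoly F[n]}})
    : {mpoly F[n]} -> Prop :=
  in_ideal (fun f => (forall g, act g f = f) /\
                     exists2 d, (0 < d)%N & f \is d.-homog).

Inductive dihedral_basis (gT : finGroupType) (F : fieldType) (r s p : nat)
    (sigma rho : gT)
    (act : gT -> {lrmorphism {mpoly F[nvars r s]} -> {mpoly F[nvars r s]}})
    : {mpoly F[nvars r s]} -> Prop :=
| Orbit_sum (m : 'X_{1..nvars r s}) of
    act rho 'X_[m] = 'X_[m] & ~ (forall g, act g 'X_[m] = 'X_[m])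
    & (mdeg m <= p)%N :
    dihedral_basis p sigma rho act ('X_[m] + act sigma 'X_[m])
| Variable_multiple (m : 'X_{1..nvars r s}) (u : 'I_(nvars r s)) of
    act rho 'X_[m] = 'X_[m] & (mdeg m <= p)%N & (U_(u) <= m)%MM :
    dihedral_basis p sigma rho act ('X_u * 'X_[m])
| Product_xy (i : 'I_r) :
    dihedral_basis p sigma rho act ('X_(ix s i) * 'X_(iy s i))
| Product_zw (j : 'I_s) :
    dihedral_basis p sigma rho act ('X_(iz r j) * 'X_(iw r j)).

(* Main.v *)
Require Import Defs.
From mathcomp Require Import all_boot all_order all_algebra all_fingroup all_solvable.
From mathcomp Require Import mpoly.
From mathcomp Require Import zify.

Set Implicit Arguments.
Unset Strict Implicit.
Unset Printing Implicit Defensive.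

Import GRing.Theory.
Local Open Scope ring_scope.

(** Write [swap m] for the monomial got from [m] by exchanging the two variables
of every pair [x_i, y_i] and [z_j, w_j], and [weight m] for the scalar by which
[rho] multiplies [m]; [m] is invariant under [rho] when [weight m = 1].

That the listed polynomials lie in the Hilbert ideal is a direct computation.
The point is that they give all leading monomials of the ideal, and the proof
replaces S-polynomials by an order-free description of the supports of the
elements of the ideal.  Call [t] linked to [t0] if [t0 = a m] and
[t = a swap m] for some [m] of weight 1.  This single-step relation is already
an equivalence relation: its transitivity ([linked_trans]) comes from refining
two factorisations of one monomial ([mnm_refine]).  An invariant [g] of positive
degree has equal coefficients at [m] and [swap m], and only monomials of weight 1
in its support.  Consider the sum of the coefficients of [a g] over the monomials
linked to a fixed [t0].  The involution [m -> swap m] groups the terms of this sum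
into equal pairs, which cancel in characteristic two, unless some [a m] with
[swap m = m] is linked to [t0].  In that case a product [u (tau u)] of two partner
variables divides a monomial linked to [t0], and then [t0] itself is divisible
by such a product, or by [u m] with [m] of weight 1 and [u] a variable dividing
[m] ([linked_pair_dead]).  Hence ([ideal_companion]): if [t0] is in the support of
an element [f] of the Hilbert ideal, either [t0] is divisible by one of these
monomials, or the support of [f] contains another monomial linked to [t0].

If [t0] is the leading monomial of [f], that other monomial [a swap m] is smaller
than [t0 = a m], so [swap m < m], and the leading monomial [m] of [m + swap m]
divides [t0].

It remains to bound degrees by [p].  Among the [p + 1] initial products of a
product of at least [p] variables, two have the same weight, since weights are
[p]-th roots of unity in a field; so each monomial of weight 1 and degree
above [p] is a product of two smaller ones ([invariant_split]).  A divisor [u m]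
shrinks to [u k] for a factor [k] of [m] that contains [u] ([invariant_cover]), and
if [swap m < m] then [swap k < k] for some factor [k], because a monomial order is
compatible with products ([invariant_descent]). *)

(** * Ideals generated by a predicate *)

Section Ideals.
Variable R : comNzRingType.
Implicit Types (S T : R -> Prop) (f g : R).

Lemma in_ideal_gen S g : S g -> in_ideal S g.
Proof.
move=> Sg; exists 1%N, (fun=> 1), (fun=> g); split=> //.
by rewrite big_ord1 mul1r.
Qed.

Lemma in_ideal0 S : in_ideal S 0.
Proof. by exists 0%N, (fun=> 0), (fun=> 0); split=> [[]|]; rewrite ?big_ord0. Qed.

Lemma in_idealD S f g : in_ideal S f -> in_ideal S g -> in_ideal S (f + g).
Proof.
move=> [k [a [u [Su ->]]]] [l [b [v [Sv ->]]]]; exists (k + l)%N.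
exists (fun i => match split i with inl x => a x | inr y => b y end).
exists (fun i => match split i with inl x => u x | inr y => v y end).
split=> [i|]; first by case: (split i).
rewrite big_split_ord /=; congr (_ + _); apply: eq_bigr => i _.
- by have := unsplitK (inl i : 'I_k + 'I_l) => /= ->.
- by have := unsplitK (inr i : 'I_k + 'I_l) => /= ->.
Qed.

Lemma in_idealMl S c f : in_ideal S f -> in_ideal S (c * f).
Proof.
move=> [k [a [u [Su ->]]]]; exists k, (fun i => c * a i), u; split=> //.
by rewrite mulr_sumr; apply: eq_bigr => i _; rewrite mulrA.
Qed.

Lemma in_ideal_incl S T f :
  (forall g, S g -> in_ideal T g) -> in_ideal S f -> in_ideal T f.
Proof.
move=> ST [k [a [u [Su ->]]]]; elim/big_ind: _ => [|g h|i _].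
- exact: in_ideal0.
- exact: in_idealD.
- by apply/in_idealMl/ST.
Qed.

End Ideals.

(** * Exponent vectors and an involution on the variables *)

(** Riesz refinement for the monoid of monomials. *)
Lemma mnm_refine n (a b c d : 'X_{1..n}) : (a + b = c + d)%MM ->
  exists a1 a2 b1 b2 : 'X_{1..n},
    [/\ a = (a1 + a2)%MM, b = (b1 + b2)%MM, c = (a1 + b1)%MM
      & d = (a2 + b2)%MM].
Proof.
move=> /mnmP abcd.
pose a1 : 'X_{1..n} := [multinom minn (a i) (c i) | i < n].
exists a1, (a - a1)%MM, (c - a1)%MM, (b - (c - a1))%MM.
by split; apply/mnmP => i; move: (abcd i); rewrite !(mnmDE, mnmBE, mnmE); lia.
Qed.

Lemma mnm1_le n (u : 'I_n) (m : 'X_{1..n}) : (U_(u) <= m)%MM = (0 < m u)%N.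
Proof.
apply/mnm_lepP/idP => [/(_ u)|m_u i]; first by rewrite mnm1E eqxx.
by rewrite mnm1E; case: eqP => [<-|].
Qed.

(** The orbits of size two contribute [E i + E i = 0]; comparing the ranks of [i]
and [h i] selects one point of each such orbit. *)
Lemma sum_involution_char2 (F : nzRingType) (I : finType) (h : I -> I)
    (E : I -> F) :
  2%N \in [pchar F] -> involutive h -> (forall i, E (h i) = E i) ->
  (forall i, h i = i -> E i = 0) -> \sum_i E i = 0.
Proof.
move=> F2 hK Eh E0; pose rk (i : I) := enum_rank i : nat.
rewrite (bigID (fun i => rk i < rk (h i))%N) /=.
rewrite [X in _ + X](bigID (fun i => rk (h i) < rk i)%N) /=.
rewrite [X in _ + (_ + X)]big1 ?addr0 => [|i]; last first.
  by rewrite -!leqNgt -eqn_leq => /eqP/val_inj/enum_rank_inj; apply: E0.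
rewrite [X in _ + X](reindex_inj (inv_inj hK)) /=.
rewrite -[RHS](addrr_pchar2 F2 (\sum_(i | (rk i < rk (h i))%N) E i)).
congr (_ + _); apply: eq_big => [i|i _]; last exact: Eh.
by rewrite hK; lia.
Qed.

Section Swap.
Variables (n : nat) (tau : 'I_n -> 'I_n).
Hypothesis tauK : involutive tau.
Hypothesis tau_neq : forall i, tau i != i.
Implicit Types (a b m t : 'X_{1..n}) (u v : 'I_n).

Definition swap m : 'X_{1..n} := [multinom m (tau i) | i < n].

Lemma swapE m i : swap m i = m (tau i).
Proof. by rewrite mnmE. Qed.

Lemma swapK : involutive swap.
Proof. by move=> m; apply/mnmP => i; rewrite !swapE tauK. Qed.

Lemma swapD a b : swap (a + b)%MM = (swap a + swap b)%MM.
Proof. by apply/mnmP => i; rewrite !(swapE, mnmDE). Qed.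

Lemma swap0 : swap 0%MM = 0%MM.
Proof. by apply/mnmP => i; rewrite swapE !mnm0E. Qed.

Lemma mdeg_swap m : mdeg (swap m) = mdeg m.
Proof.
rewrite !mdegE (reindex_inj (inv_inj tauK)) /=.
by apply: eq_bigr => i _; rewrite swapE tauK.
Qed.

Lemma mnm1_le_swap u m : (U_(u) <= swap m)%MM = (U_(tau u) <= m)%MM.
Proof. by rewrite !mnm1_le swapE. Qed.

Lemma pair_le u m :
  (U_(u) + U_(tau u) <= m)%MM = (U_(u) <= m)%MM && (U_(tau u) <= m)%MM.
Proof.
rewrite !mnm1_le; apply/mnm_lepP/andP => [le_m|[m_u m_tu] i].
  by move: (le_m u) (le_m (tau u)); rewrite !mnmDE !mnm1E !eqxx; lia.
rewrite mnmDE !mnm1E; case: (eqVneq u i) => [<-|_].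
  by rewrite (negbTE (tau_neq u)).
by case: eqP => [<-|].
Qed.

Lemma swap_fixed_pair m : m != 0%MM -> swap m = m ->
  exists u, (U_(u) + U_(tau u) <= m)%MM.
Proof.
move=> m_neq0 m_fix; have [u m_u|m0] := pickP (fun u => 0 < m u)%N; last first.
  case/eqP: m_neq0; apply/mnmP => i; rewrite mnm0E.
  by apply/eqP; rewrite -leqn0 leqNgt m0.
by exists u; rewrite pair_le -mnm1_le_swap m_fix mnm1_le m_u.
Qed.

(** * Linked monomials *)

Section Weight.
Variables (F : fieldType) (chi : 'I_n -> F).
Hypothesis chi_neq0 : forall i, chi i != 0.
Hypothesis chi_tau : forall i, chi (tau i) = (chi i)^-1.

Definition weight m : F := \prod_i chi i ^+ m i.

Lemma weightD a b : weight (a + b)%MM = weight a * weight b.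
Proof. by rewrite -big_split; apply: eq_bigr => i _; rewrite mnmDE exprD. Qed.

Lemma weight0 : weight 0%MM = 1.
Proof. by rewrite /weight big1 // => i _; rewrite mnm0E. Qed.

Lemma weight_neq0 m : weight m != 0.
Proof. by apply/prodf_neq0 => i _; rewrite expf_neq0. Qed.

Lemma weight_swap m : weight (swap m) = (weight m)^-1.
Proof.
rewrite /weight (reindex_inj (inv_inj tauK)) -prodfV; apply: eq_bigr => i _ /=.
by rewrite swapE tauK chi_tau exprVn.
Qed.

Lemma weight_mulI a b : weight a = 1 -> weight (a + b)%MM = 1 -> weight b = 1.
Proof. by rewrite weightD => ->; rewrite mul1r. Qed.

(** [t0 = a m] and [t = a swap m] with [m] of weight 1, see [linkedP]; the bound on
the degree of [m] only serves to make the relation decidable. *)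
Definition linked t0 t :=
  [exists m : 'X_{1..n < (mdeg t0).+1},
    [&& weight m == 1, (m <= t0)%MM & t == (t0 - m + swap m)%MM]].

Lemma linkedP t0 t :
  reflect (exists a m,
    [/\ weight m = 1, t0 = (a + m)%MM & t = (a + swap m)%MM]) (linked t0 t).
Proof.
apply: (iffP existsP) => [[m /and3P[/eqP wm le_m /eqP ->]]|[a [m [wm -> ->]]]].
  by exists (t0 - m)%MM, m; rewrite submK.
have bm : (mdeg m < (mdeg (a + m)%MM).+1)%N by rewrite mdegD; lia.
by exists (BMultinom bm); rewrite /= wm eqxx lem_addl addmK /=.
Qed.

Lemma linked_refl t : linked t t.
Proof.
by apply/linkedP; exists t, 0%MM; rewrite weight0 swap0 addm0.
Qed.

(** If [a swap m = b k], refine it as [a = a1 a2], [swap m = m1 m2], [b = a1 m1],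
[k = a2 m2].  Since [m] and [k] have weight 1, [a2] and [m1] both have the weight
inverse to that of [m2], so exchanging [a2 swap m1] is again an allowed step, and
it leads from [a m] to [b swap k]. *)
Lemma linked_trans t1 t0 t2 : linked t0 t1 -> linked t1 t2 -> linked t0 t2.
Proof.
move=> /linkedP[a [m [wm -> ->]]] /linkedP[b [k [wk eq_t1 ->]]]; apply/linkedP.
have [a1 [a2 [m1 [m2 [-> def_m -> def_k]]]]] := mnm_refine eq_t1.
have {}def_m : m = (swap m1 + swap m2)%MM by rewrite -swapD -def_m swapK.
exists (a1 + swap m2)%MM, (a2 + swap m1)%MM; split.
- have w1 : weight m1 * weight m2 = 1.
    by apply: invr_inj; rewrite invr1 -wm def_m weightD !weight_swap invfM.
  suff a2_m1: weight a2 = weight m1.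
    by rewrite weightD weight_swap a2_m1 divff ?weight_neq0.
  by apply: (mulIf (weight_neq0 m2)); rewrite w1 -wk def_k weightD.
- by apply/mnmP => i; rewrite def_m !mnmDE; lia.
- by rewrite def_k !swapD swapK; apply/mnmP => i; rewrite !mnmDE; lia.
Qed.

Lemma linked_exchange t0 a m : weight m = 1 ->
  linked t0 (a + swap m)%MM = linked t0 (a + m)%MM.
Proof.
move=> wm; apply/idP/idP => /linked_trans; apply; apply/linkedP.
  by exists a, (swap m); rewrite weight_swap wm invr1 swapK.
by exists a, m.
Qed.

Lemma linked_mdeg t0 t : linked t0 t -> mdeg t = mdeg t0.
Proof. by move=> /linkedP[a [m [_ -> ->]]]; rewrite !mdegD mdeg_swap. Qed.

(** Divisibility by one of the monomials of the basis, up to the degree bound. *)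
Definition dead t := exists u,
  (U_(u) + U_(tau u) <= t)%MM \/
  exists m, [/\ weight m = 1, (U_(u) <= m)%MM & (U_(u) + m <= t)%MM].

(** In [a swap m], the variables [u] and [tau u] may both come from [a] or both
from [swap m]: then the pair also divides [a m].  Otherwise one of them divides
both [a] and [m]. *)
Lemma linked_pair_dead t0 t u :
  linked t0 t -> (U_(u) + U_(tau u) <= t)%MM -> dead t0.
Proof.
move=> /linkedP[a [m [wm -> ->]]] pair_t; rewrite /dead.
have le_Dl v : (U_(v) <= a + swap m)%MM ->
    (U_(v) <= a)%MM || (U_(tau v) <= m)%MM.
  by rewrite !mnm1_le mnmDE swapE addn_gt0.
have pair_dead v : (U_(v) <= a)%MM -> (U_(v) <= m)%MM -> dead (a + m).
  move=> v_a v_m; exists v; right; exists m; split=> //.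
  by apply/mnm_lepP => i; rewrite !mnmDE leq_add2r (mnm_lepP v_a).
move: pair_t; rewrite pair_le => /andP[/le_Dl/orP u_t /le_Dl/orP]; rewrite tauK.
case: u_t => [u_a|tu_m] [tu_a|u_m].
- by exists u; left; rewrite (lepm_trans _ (lem_addr _ _)) ?pair_le ?u_a.
- exact: pair_dead u_a u_m.
- exact: pair_dead tu_a tu_m.
- by exists u; left; rewrite (lepm_trans _ (lem_addl _ _)) ?pair_le ?u_m.
Qed.

Section Involution.
Hypothesis F2 : 2%N \in [pchar F].

(** The properties of homogeneous invariants of positive degree used below, in terms
of coefficients. *)
Definition dihedral_invariant (g : {mpoly F[n]}) :=
  [/\ forall m, g@_(swap m) = g@_m,
      forall m, m \in msupp g -> weight m = 1 & 0%MM \notin msupp g].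

(** Linked monomials have the same degree, so this finite sum runs over the whole
class of [t0], and it is linear in [f]. *)
Definition link_sum t0 (f : {mpoly F[n]}) : F :=
  \sum_(t : 'X_{1..n < (mdeg t0).+1} | linked t0 t) f@_t.

Lemma link_sumD t0 f g : link_sum t0 (f + g) = link_sum t0 f + link_sum t0 g.
Proof. by rewrite -big_split; apply: eq_bigr => t _; rewrite mcoeffD. Qed.

Lemma link_sumZ t0 c f : link_sum t0 (c *: f) = c * link_sum t0 f.
Proof. by rewrite mulr_sumr; apply: eq_bigr => t _; rewrite mcoeffZ. Qed.

Lemma link_sum0 t0 : link_sum t0 0 = 0.
Proof. by rewrite /link_sum big1 // => t _; rewrite mcoeff0. Qed.

Lemma link_sumX t0 t : link_sum t0 'X_[t] = (linked t0 t)%:R.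
Proof.
rewrite /link_sum; case: (boolP (linked t0 t)) => [lt|nlt].
  have bt : (mdeg t < (mdeg t0).+1)%N by rewrite (linked_mdeg lt).
  rewrite (bigD1 (BMultinom bt)) //= mcoeffX eqxx big1 ?addr0 // => k /andP[_].
  by rewrite mcoeffX -val_eqE /= eq_sym => /negbTE->.
rewrite big1 // => k; rewrite mcoeffX; case: eqP => [<-|//].
by rewrite (negbTE nlt).
Qed.

(** By linearity it is enough to treat ['X_[a] * h] with [h] invariant, whose sum is
that of [h@_m] over the [m] with [a m] linked to [t0].  Exchanging [m] for [swap m]
preserves the condition and the coefficient; a fixed [m] contains a pair of
partner variables, so it does not occur. *)
Lemma link_sum_ideal t0 f :
  (forall t u, linked t0 t -> ~~ (U_(u) + U_(tau u) <= t)%MM) ->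
  in_ideal dihedral_invariant f -> link_sum t0 f = 0.
Proof.
move=> no_pair [k [c [g [inv_g ->]]]].
elim/big_ind: _ => [|x y x0 y0|i _]; first exact: link_sum0.
  by rewrite link_sumD x0 y0 addr0.
move: (g i) (inv_g i) => {inv_g}h [h_swap h_wt h_pos].
rewrite (mpolyE (c i)) mulr_suml; elim/big_ind: _ => [|x y x0 y0|a _].
- exact: link_sum0.
- by rewrite link_sumD x0 y0 addr0.
rewrite -scalerAl link_sumZ {1}(mpolywE (leqnn (msize h))).
rewrite [X in link_sum _ X]mulr_sumr.
rewrite (big_morph (link_sum t0) (link_sumD t0) (link_sum0 t0)).
pose E (m : 'X_{1..n < msize h}) := link_sum t0 ('X_[a] * (h@_m *: 'X_[m])).
have EE (m : 'X_{1..n < msize h}) : E m = h@_m * (linked t0 (a + m)%MM)%:R.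
  by rewrite /E -scalerAr link_sumZ -mpolyXD link_sumX.
have bd (m : 'X_{1..n < msize h}) : (mdeg (swap m) < msize h)%N.
  by rewrite mdeg_swap; case: m.
pose bswap (m : 'X_{1..n < msize h}) : 'X_{1..n < msize h} := BMultinom (bd m).
rewrite (@sum_involution_char2 F _ bswap E) ?mulr0 //.
- by move=> m; apply: val_inj; rewrite /= swapK.
- move=> m; rewrite !EE /= h_swap; case: (boolP (val m \in msupp h)) => [/h_wt wm|].
    by rewrite linked_exchange.
  by move=> /memN_msupp_eq0->; rewrite !mul0r.
- move=> m /(congr1 val)/= m_fix; rewrite EE.
  case: (boolP (val m \in msupp h)) => [m_h|]; last first.
    by move=> /memN_msupp_eq0->; rewrite mul0r.
  have m_neq0 : val m != 0%MM by apply: contraNneq h_pos => <-.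
  have [u pair_m] := swap_fixed_pair m_neq0 m_fix.
  case: (boolP (linked t0 _)) => [lt|_]; last by rewrite mulr0.
  by have := no_pair _ u lt; rewrite (lepm_trans pair_m (lem_addl _ _)).
Qed.

(** Otherwise [link_sum t0 f] would reduce to the nonzero coefficient of [f] at
[t0], whereas it vanishes on the ideal. *)
Lemma ideal_companion f t0 :
  in_ideal dihedral_invariant f -> t0 \in msupp f ->
  dead t0 \/ exists2 t, t \in msupp f & (t != t0) && linked t0 t.
Proof.
move=> f_in t0_f.
case: (boolP [exists t : 'X_{1..n < (mdeg t0).+1}, linked t0 t &&
                [exists u, (U_(u) + U_(tau u) <= t)%MM]]) => [|no_pair].
  move=> /existsP[t /andP[lt /existsP[u pair_t]]]; left.
  exact: linked_pair_dead lt pair_t.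
right; apply/hasP; apply: contraLR t0_f => /hasPn alone.
suff: link_sum t0 f = 0.
  rewrite /link_sum (bigD1 (BMultinom (ltnSn (mdeg t0)))) ?linked_refl //=.
  rewrite big1 ?addr0 => [f0|t /andP[lt t_neq]].
    by rewrite mcoeff_msupp f0 eqxx.
  apply: memN_msupp_eq0; apply: contraTN lt => /alone.
  by rewrite -val_eqE /= in t_neq; rewrite t_neq.
apply: link_sum_ideal f_in => t u lt; apply: contra no_pair => pair_t.
have bt : (mdeg t < (mdeg t0).+1)%N by rewrite (linked_mdeg lt).
by apply/existsP; exists (BMultinom bt); rewrite lt; apply/existsP; exists u.
Qed.

End Involution.

(** * Reduction to degree at most p *)

Section DegreeBound.
Variable p : nat.
Hypothesis p_gt0 : (0 < p)%N.
Hypothesis chi_root : forall i, chi i ^+ p = 1.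

Lemma weight_root m : weight m ^+ p = 1.
Proof.
rewrite /weight -prodrXl big1 // => i _.
by rewrite -exprM mulnC exprM chi_root expr1n.
Qed.

Lemma s2m_cat (s1 s2 : seq 'I_n) : s2m (s1 ++ s2) = (s2m s1 + s2m s2)%MM.
Proof. by apply/mnmP => i; rewrite mnmDE !mnmE count_cat. Qed.

Lemma mdeg_s2m (s : seq 'I_n) : mdeg (s2m s) = size s.
Proof.
elim: s => [|i s IHs]; first by rewrite mdegE big1 // => i; rewrite mnmE.
rewrite -cat1s s2m_cat mdegD IHs size_cat; congr (_ + _)%N.
rewrite -[RHS](mdeg1 i); congr mdeg; apply/mnmP => j.
by rewrite mnmE mnm1E /= addn0.
Qed.

(** Two of the [p + 1] weights of the initial segments of lengths [0..p] of the list
of variables of [m] coincide, as the field has at most [p] roots of unity of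
order dividing [p].  The segment between them is nonempty, has weight 1 and length
at most [p], hence is a proper factor of [m]. *)
Lemma invariant_split m : weight m = 1 -> (p < mdeg m)%N ->
  exists m1 m2, [/\ m = (m1 + m2)%MM, weight m1 = 1, weight m2 = 1,
    (mdeg m1 < mdeg m)%N & (mdeg m2 < mdeg m)%N].
Proof.
move=> wm lt_pm; pose s := m2s m.
pose ws := mkseq (fun k => weight (s2m (take k s))) p.+1.
have /uniqPn-/(_ 0)[i [j []]] : ~~ uniq ws.
  apply: contraTN (ltnSn p) => uniq_ws; rewrite -leqNgt.
  rewrite -[X in (X <= _)%N](size_mkseq (fun k => weight (s2m (take k s))) p.+1).
  apply: max_unity_roots uniq_ws => //; apply/allP => _ /mapP[k _ ->].
  by rewrite unity_rootE weight_root.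
rewrite size_mkseq => lt_ij lt_jp.
rewrite !nth_mkseq ?(ltn_trans lt_ij) // => eq_w.
pose c := drop i (take j s).
have take_j : take j s = take i s ++ c.
  by rewrite -[LHS](cat_take_drop i) take_takel // ltnW.
have def_m : m = ((s2m (take i s) + s2m (drop j s)) + s2m c)%MM.
  rewrite -[LHS]s2mK -/s -[in LHS](cat_take_drop j s) take_j !s2m_cat.
  by rewrite -!addmA; congr (_ + _)%MM; rewrite addmC.
have wc : weight (s2m c) = 1.
  apply: (mulfI (weight_neq0 (s2m (take i s)))).
  by rewrite mulr1 -weightD -s2m_cat -take_j.
have size_c : size c = (j - i)%N.
  by rewrite size_drop size_takel // size_m2s; lia.
exists (s2m c), (s2m (take i s) + s2m (drop j s))%MM.
have deg_m : mdeg m = (mdeg (s2m (take i s) + s2m (drop j s))%MM + (j - i))%N.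
  by rewrite {1}def_m mdegD (mdeg_s2m c) size_c.
split; first by rewrite addmC.
- exact: wc.
- by apply: (weight_mulI wc); rewrite addmC -def_m.
- by rewrite mdeg_s2m size_c; lia.
- by rewrite deg_m; lia.
Qed.

Lemma invariant_ind (P : 'X_{1..n} -> Prop) :
  (forall m, weight m = 1 -> (mdeg m <= p)%N -> P m) ->
  (forall m1 m2, weight m1 = 1 -> weight m2 = 1 -> P m1 -> P m2 ->
     P (m1 + m2)%MM) ->
  forall m, weight m = 1 -> P m.
Proof.
move=> P_small P_add m; have [d] := ubnP (mdeg m).
elim: d m => // d IHd m lt_md wm.
case: (leqP (mdeg m) p) => [m_p|lt_pm]; first exact: P_small.
have [m1 [m2 [def_m w1 w2 lt1 lt2]]] := invariant_split wm lt_pm.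
by rewrite def_m; apply: P_add => //; apply: IHd => //; lia.
Qed.

Lemma invariant_cover m u : weight m = 1 -> (U_(u) <= m)%MM ->
  exists k, [/\ weight k = 1, (mdeg k <= p)%N, (U_(u) <= k)%MM & (k <= m)%MM].
Proof.
move=> wm; move: m wm.
apply: invariant_ind => [m wm m_p m_u|m1 m2 _ _ IH1 IH2].
  by exists m; rewrite lepm_refl.
rewrite mnm1_le mnmDE addn_gt0 -!mnm1_le => /orP[/IH1|/IH2] [k [wk k_p k_u le_k]].
  by exists k; rewrite (lepm_trans le_k (lem_addr _ _)).
by exists k; rewrite (lepm_trans le_k (lem_addl _ _)).
Qed.

Section Order.
Variable le : rel 'X_{1..n}.
Hypothesis le_order : monomial_order le.

(** If neither factor of [m = m1 m2] were larger than its swap, then [m <= swap m],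
so [m] would equal its swap. *)
Lemma invariant_descent m : weight m = 1 -> swap m != m -> le (swap m) m ->
  exists k, [/\ weight k = 1, (mdeg k <= p)%N, swap k != k, le (swap k) k
    & (k <= m)%MM].
Proof.
have [[le_refl le_anti le_trans le_total] [_ le_add]] := le_order.
move=> wm; move: m wm.
apply: invariant_ind => [m wm m_p m_neq m_le|m1 m2 _ _ IH1 IH2].
  by exists m; rewrite lepm_refl.
move=> m_neq m_le.
have not_le k : ~~ le k (swap k) -> swap k != k /\ le (swap k) k.
  move=> nle; have := le_total (swap k) k; rewrite (negbTE nle) orbF => ->.
  by split=> //; apply: contraNneq nle => ->; apply: le_refl.
case: (boolP (le m1 (swap m1))) => [le1|/not_le[neq1 le1]]; last first.
  have [k [wk k_p k_neq k_le le_k]] := IH1 neq1 le1.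
  by exists k; rewrite (lepm_trans le_k (lem_addr _ _)).
case: (boolP (le m2 (swap m2))) => [le2|/not_le[neq2 le2]]; last first.
  have [k [wk k_p k_neq k_le le_k]] := IH2 neq2 le2.
  by exists k; rewrite (lepm_trans le_k (lem_addl _ _)).
case/eqP: m_neq; apply: le_anti; rewrite m_le swapD /=.
apply: (le_trans (swap m1 + m2)%MM); first exact: le_add.
by rewrite ![(swap m1 + _)%MM]addmC; apply: le_add.
Qed.

End Order.
End DegreeBound.

(** * Algebra maps acting on monomials by swap and by weight *)

Section Action.
Variables s r : {lrmorphism {mpoly F[n]} -> {mpoly F[n]}}.
Hypothesis s_var : forall i, s 'X_i = 'X_(tau i).
Hypothesis r_var : forall i, r 'X_i = chi i *: 'X_i.

Lemma swap_act_monomial m : s 'X_[m] = 'X_[swap m].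
Proof.
rewrite [in LHS]mpolyXE_id rmorph_prod mpolyXE_id (reindex_inj (inv_inj tauK)) /=.
by apply: eq_bigr => i _; rewrite rmorphXn /= s_var tauK swapE.
Qed.

Lemma weight_act_monomial m : r 'X_[m] = weight m *: 'X_[m].
Proof.
rewrite mpolyXE_id rmorph_prod -scaler_prod.
by apply: eq_bigr => i _; rewrite rmorphXn /= r_var exprZn.
Qed.

Lemma mcoeff_swap_act f m : (s f)@_m = f@_(swap m).
Proof.
rewrite {1}(mpolyE f) [in RHS](mpolyE f) !raddf_sum /=; apply: eq_bigr => k _.
by rewrite linearZ /= swap_act_monomial !mcoeffZ !mcoeffX (inv_eq swapK).
Qed.

Lemma mcoeff_weight_act f m : (r f)@_m = weight m * f@_m.
Proof.
rewrite {1}(mpolyE f) [in RHS](mpolyE f) !raddf_sum mulr_sumr /=.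
apply: eq_bigr => k _.
rewrite linearZ /= weight_act_monomial !mcoeffZ !mcoeffX.
by case: eqP => [->|_]; rewrite ?mulr0 // !mulr1 mulrC.
Qed.

Lemma fixed_dihedral_invariant g d :
  s g = g -> r g = g -> (0 < d)%N -> g \is d.-homog -> dihedral_invariant g.
Proof.
move=> sg rg d_gt0 g_homog; split=> [m|m m_g|].
- by rewrite -{2}sg mcoeff_swap_act.
- apply: (mulIf (x := g@_m)); first by rewrite -mcoeff_msupp.
  by rewrite mul1r -mcoeff_weight_act rg.
- apply/negP => /(dhomog_mf g_homog) /=; rewrite mdeg0 => d0.
  by rewrite -d0 in d_gt0.
Qed.

End Action.
End Weight.
End Swap.

(** * The four blocks of variables *)

Section Variables.
Variables r s : nat.

Definition on_blocks T (fx fy : 'I_r -> T) (fz fw : 'I_s -> T)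
    (i : 'I_(nvars r s)) : T :=
  match split i with
  | inl a => match split a with inl j => fx j | inr j => fy j end
  | inr b => match split b with inl j => fz j | inr j => fw j end
  end.

Variant var_spec : 'I_(nvars r s) -> Type :=
| VarX i : var_spec (ix s i)
| VarY i : var_spec (iy s i)
| VarZ j : var_spec (iz r j)
| VarW j : var_spec (iw r j).

Lemma varP i : var_spec i.
Proof.
by case: (split_ordP i) => k ->; case: (split_ordP k) => j ->; constructor.
Qed.

Section OnBlocks.
Variables (T : Type) (fx fy : 'I_r -> T) (fz fw : 'I_s -> T).
Notation f := (on_blocks fx fy fz fw).

Lemma on_blocks_x i : f (ix s i) = fx i.
Proof. by rewrite /on_blocks /ix (unsplitK (inl _)) (unsplitK (inl i)). Qed.

Lemma on_blocks_y i : f (iy s i) = fy i.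
Proof. by rewrite /on_blocks /iy (unsplitK (inl _)) (unsplitK (inr i)). Qed.

Lemma on_blocks_z j : f (iz r j) = fz j.
Proof. by rewrite /on_blocks /iz (unsplitK (inr _)) (unsplitK (inl j)). Qed.

Lemma on_blocks_w j : f (iw r j) = fw j.
Proof. by rewrite /on_blocks /iw (unsplitK (inr _)) (unsplitK (inr j)). Qed.

End OnBlocks.

Definition on_blocksE := (on_blocks_x, on_blocks_y, on_blocks_z, on_blocks_w).

Definition partner : 'I_(nvars r s) -> 'I_(nvars r s) :=
  on_blocks (iy s) (ix s) (iw r) (iz r).

Lemma partnerK : involutive partner.
Proof.
by move=> i; case: (varP i) => j; rewrite /partner !on_blocksE.
Qed.

Lemma partner_neq i : partner i != i.
Proof.
case: (varP i) => j; rewrite /partner !on_blocksE -val_eqE /=.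
all: by have := ltn_ord j; lia.
Qed.
End Variables.

(** * The dihedral group and the Hilbert ideal *)

Section Dihedral.
Variables (gT : finGroupType) (F : fieldType) (p r s : nat).
Hypothesis F2 : 2%N \in [pchar F].
Hypothesis p_gt0 : (0 < p)%N.
Variable lambda : 'I_r -> F.
Hypothesis lambda_root : forall i, lambda i ^+ p = 1.
Variables (sigma rho : gT).
Hypothesis gen : <<[set sigma; rho]>>%g = [set: gT].
Variable act : gT -> {lrmorphism {mpoly F[nvars r s]} -> {mpoly F[nvars r s]}}.
Hypothesis act_graded : graded_action act.
Hypothesis act_vars : dihedral_on_variables lambda sigma rho act.

Notation tau := (@partner r s).
Notation n := (nvars r s).
Notation swap := (swap tau).
Notation basis := (dihedral_basis p sigma rho act).

Definition eigenvalue : 'I_n -> F :=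
  on_blocks lambda (fun i => (lambda i)^-1) (fun=> 1) (fun=> 1).

Notation weight := (weight eigenvalue).

Lemma eigenvalue_root i : eigenvalue i ^+ p = 1.
Proof.
case: (varP i) => j; rewrite /eigenvalue !on_blocksE ?expr1n //.
by rewrite exprVn lambda_root invr1.
Qed.

Lemma eigenvalue_neq0 i : eigenvalue i != 0.
Proof.
have := oner_neq0 F; rewrite -(eigenvalue_root i); apply: contra_neq => ->.
by rewrite expr0n eqn0Ngt p_gt0.
Qed.

Lemma eigenvalue_partner i : eigenvalue (tau i) = (eigenvalue i)^-1.
Proof.
case: (varP i) => j; rewrite /partner !on_blocksE /eigenvalue !on_blocksE.
all: by rewrite ?invrK ?invr1.
Qed.

Lemma act_sigma_var i : act sigma 'X_i = 'X_(tau i).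
Proof.
have [sx sz _ _] := act_vars.
case: (varP i) => j; rewrite /partner !on_blocksE.
- by have [] := sx j.
- by have [] := sx j.
- by have [] := sz j.
- by have [] := sz j.
Qed.

Lemma act_rho_var i : act rho 'X_i = eigenvalue i *: 'X_i.
Proof.
have [_ _ rx rz] := act_vars.
case: (varP i) => j; rewrite /eigenvalue !on_blocksE ?scale1r.
- by have [] := rx j.
- by have [] := rx j.
- by have [] := rz j.
- by have [] := rz j.
Qed.

Lemma act_sigmaX m : act sigma 'X_[m] = 'X_[swap m].
Proof. exact: (swap_act_monomial (@partnerK r s) act_sigma_var). Qed.

Lemma act_rhoX m : act rho 'X_[m] = weight m *: 'X_[m].
Proof. exact: weight_act_monomial act_rho_var m. Qed.

Lemma act_rhoX_fixed m : act rho 'X_[m] = 'X_[m] <-> weight m = 1.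
Proof.
rewrite act_rhoX; split=> [/(congr1 (fun f => f@_m))|->]; last by rewrite scale1r.
by rewrite mcoeffZ mcoeffX eqxx mulr1.
Qed.

Lemma fixed_by_generators f :
  act sigma f = f -> act rho f = f -> forall g, act g f = f.
Proof.
have [act1 actM _] := act_graded; move=> sf rf g.
have stabG : group_set [set g | act g f == f].
  apply/group_setP; split=> [|a b]; first by rewrite inE act1.
  by rewrite !inE actM => /eqP fa /eqP fb; rewrite fb fa.
have sub : <<[set sigma; rho]>>%g \subset Group stabG.
  by rewrite gen_subG; apply/subsetP => x /set2P[]->; rewrite inE ?sf ?rf.
by have := subsetP sub g; rewrite gen inE => /(_ isT); rewrite inE => /eqP.
Qed.

Lemma fixed_monomial m : weight m = 1 ->
  (forall g, act g 'X_[m] = 'X_[m]) <-> swap m = m.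
Proof.
move=> /act_rhoX_fixed rm; split=> [/(_ sigma)|m_fix].
  rewrite act_sigmaX => /(congr1 (mcoeff m)); rewrite !mcoeffX eqxx.
  by case: eqP => // _ /esym/eqP; rewrite oner_eq0.
by apply: fixed_by_generators => //; rewrite act_sigmaX m_fix.
Qed.

Lemma orbit_sum_hilbert m : weight m = 1 -> m != 0%MM ->
  hilbert_ideal act ('X_[m] + 'X_[swap m]).
Proof.
move=> wm m_neq0; apply: in_ideal_gen; split.
  apply: fixed_by_generators.
    rewrite rmorphD /= !act_sigmaX (swapK (@partnerK r s)).
    exact: addrC.
  rewrite rmorphD /= !act_rhoX (weight_swap (@partnerK r s) eigenvalue_partner).
  by rewrite wm invr1 !scale1r.
exists (mdeg m); first by rewrite lt0n mdeg_eq0.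
by rewrite rpredD // dhomogX //= (mdeg_swap (@partnerK r s)).
Qed.

Lemma pair_hilbert i : hilbert_ideal act ('X_i * 'X_(tau i)).
Proof.
apply: in_ideal_gen; split.
  apply: fixed_by_generators; rewrite rmorphM /=.
    by rewrite !act_sigma_var partnerK mulrC.
  rewrite !act_rho_var eigenvalue_partner -scalerAl -scalerAr scalerA.
  by rewrite divff ?scale1r ?eigenvalue_neq0.
by exists 2%N; rewrite // -mpolyXD dhomogX /= mdegD !mdeg1.
Qed.

(** For a variable [u] dividing [m], [u m = u (m + swap m) + u swap m]; the last
term is a multiple of the invariant [u (tau u)], since [tau u] divides [swap m]. *)
Lemma basis_hilbert f : basis f -> hilbert_ideal act f.
Proof.
case=> {f}[m /act_rhoX_fixed wm not_fix _|m u /act_rhoX_fixed wm _ u_m|i|j].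
- rewrite act_sigmaX; apply: orbit_sum_hilbert => //.
  apply: contra_not_neq not_fix => m0; apply/fixed_monomial => //.
  by rewrite m0 swap0.
- have -> : 'X_u * 'X_[m] = 'X_u * ('X_[m] + 'X_[swap m])
      + 'X_[swap m - U_(tau u)] * ('X_u * 'X_(tau u)) :> {mpoly F[n]}.
    have -> : 'X_[swap m - U_(tau u)] * ('X_u * 'X_(tau u))
        = 'X_u * 'X_[swap m] :> {mpoly F[n]}.
      by rewrite mulrCA -[in LHS]mpolyXD submK // mnm1_le_swap partnerK.
    have addff (h : {mpoly F[n]}) : h + h = 0.
      by rewrite -[h]scale1r -scalerDl addrr_pchar2 ?scale0r.
    by rewrite mulrDr -addrA addff addr0.
  apply: in_idealD; apply: in_idealMl; last exact: pair_hilbert.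
  apply: orbit_sum_hilbert => //; apply: contraTneq u_m => ->.
  by rewrite mnm1_le mnm0E.
- by have := pair_hilbert (ix s i); rewrite /partner on_blocksE.
- by have := pair_hilbert (iz r j); rewrite /partner on_blocksE.
Qed.

Lemma basis_pair i : basis ('X_i * 'X_(tau i)).
Proof.
case: (varP i) => j; rewrite /partner !on_blocksE; first exact: Product_xy.
- by rewrite mulrC; apply: Product_xy.
- exact: Product_zw.
- by rewrite mulrC; apply: Product_zw.
Qed.

Lemma hilbert_dihedral_invariant f :
  hilbert_ideal act f -> in_ideal (dihedral_invariant tau eigenvalue) f.
Proof.
apply: in_ideal_incl => g [g_inv [d d_gt0 g_homog]]; apply: in_ideal_gen.
exact: (fixed_dihedral_invariant (@partnerK r s) act_sigma_var act_rho_var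
          _ _ d_gt0 g_homog).
Qed.

Lemma basis_finite : exists fs : seq {mpoly F[n]}, forall f, basis f <-> f \in fs.
Proof.
pose orbit_ok (m : 'X_{1..n < p.+1}) :=
  (act rho 'X_[m] == 'X_[m]) && ~~ [forall g, act g 'X_[m] == 'X_[m]].
pose mult_ok (q : 'X_{1..n < p.+1} * 'I_n) :=
  (act rho 'X_[q.1] == 'X_[q.1]) && (U_(q.2) <= q.1)%MM.
exists ([seq 'X_[m] + act sigma 'X_[m] | m : 'X_{1..n < p.+1} in orbit_ok]
  ++ [seq 'X_(q.2) * 'X_[q.1] | q : 'X_{1..n < p.+1} * 'I_n in mult_ok]
  ++ [seq 'X_(ix s i) * 'X_(iy s i) | i : 'I_r]
  ++ [seq 'X_(iz r j) * 'X_(iw r j) | j : 'I_s]) => f; split.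
  rewrite !mem_cat; case=> {f}[m rm not_fix m_p|m u rm m_p u_m|i|j].
  - rewrite -ltnS in m_p; apply/orP; left; apply/imageP.
    exists (BMultinom m_p) => //; rewrite unfold_in /orbit_ok /= rm eqxx /=.
    by apply/forallP => fix_m; apply: not_fix => g; apply/eqP.
  - rewrite -ltnS in m_p; apply/or4P; apply: Or42; apply/imageP.
    by exists (BMultinom m_p, u) => //; rewrite unfold_in /mult_ok /= rm eqxx.
  - by apply/or4P; apply: Or43; apply: image_f.
  - by apply/or4P; apply: Or44; apply: image_f.
rewrite !mem_cat => /or4P[] /imageP[].
- move=> m /andP[/eqP rm /forallP not_fix] ->; apply: Orbit_sum => //.
    by move=> fix_m; case: not_fix => g; rewrite fix_m.
  by case: m {rm not_fix}.
- move=> [m u] /andP[/= /eqP rm u_m] ->; apply: Variable_multiple => //.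
  by case: m {rm u_m}.
- by move=> i _ ->; apply: Product_xy.
- by move=> j _ ->; apply: Product_zw.
Qed.

Section Order.
Variable le : rel 'X_{1..n}.
Hypothesis le_order : monomial_order le.

Lemma leadingX m : is_leading le ('X_[m] : {mpoly F[n]}) m.
Proof.
have [[le_refl _ _ _] _] := le_order.
by split=> [|k]; rewrite msuppX inE // => /eqP->; apply: le_refl.
Qed.

Lemma leading_orbit_sum m : swap m != m -> le (swap m) m ->
  is_leading le ('X_[m] + 'X_[swap m] : {mpoly F[n]}) m.
Proof.
have [[le_refl _ _ _] _] := le_order => m_neq m_le; split=> [|k].
  by rewrite mcoeff_msupp mcoeffD !mcoeffX eqxx (negbTE m_neq) addr0 oner_eq0.
move=> /msuppD_le; rewrite mem_cat !msuppX !inE => /orP[]/eqP-> //.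
Qed.

Lemma leading_ideal_dvd (S : {mpoly F[n]} -> Prop) f m t :
  S f -> is_leading le f m -> (m <= t)%MM -> leading_ideal le S 'X_[t].
Proof.
move=> Sf f_m m_t; rewrite -(submK m_t) mpolyXD.
by apply/in_idealMl/in_ideal_gen; exists f, m.
Qed.

(** In the companion case the other monomial of the support is smaller than [t], and
it comes from [t] by exchanging a factor [m] for [swap m], so [swap m < m]. *)
Lemma hilbert_leading f t : hilbert_ideal act f -> is_leading le f t ->
  leading_ideal le basis 'X_[t].
Proof.
move=> /hilbert_dihedral_invariant f_in [t_f t_max].
have [[_ le_anti _ le_total] [_ le_add]] := le_order.
have [|[k k_f /andP[k_neq]]] :=
  ideal_companion (@partnerK r s) (@partner_neq r s) eigenvalue_neq0
    eigenvalue_partner F2 f_in t_f.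
- case=> u [pair_t|[m [wm u_m um_t]]].
    apply: leading_ideal_dvd (basis_pair u) _ pair_t.
    by rewrite -mpolyXD; apply: leadingX.
  have [k [wk k_p u_k le_k]] :=
    invariant_cover eigenvalue_neq0 p_gt0 eigenvalue_root wm u_m.
  apply: (leading_ideal_dvd (m := (U_(u) + k)%MM) (f := 'X_u * 'X_[k])).
  + by apply: Variable_multiple => //; apply/act_rhoX_fixed.
  + by rewrite -mpolyXD; apply: leadingX.
  + apply: lepm_trans um_t; apply/mnm_lepP => i.
    by rewrite !mnmDE leq_add2l (mnm_lepP le_k).
- move=> /linkedP[a [m [wm def_t def_k]]].
  have swap_neq : swap m != m.
    by apply: contraNneq k_neq => m_fix; rewrite def_k def_t m_fix.
  have swap_le : le (swap m) m.
    have [//|le_m] := orP (le_total (swap m) m).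
    have le_tk : le t k by rewrite def_t def_k ![(a + _)%MM]addmC; apply: le_add.
    by case/eqP: k_neq; apply: le_anti; rewrite le_tk t_max.
  have [c [wc c_p c_neq c_le c_m]] :=
    invariant_descent eigenvalue_neq0 p_gt0 eigenvalue_root le_order wm
      swap_neq swap_le.
  apply: (leading_ideal_dvd (f := 'X_[c] + 'X_[swap c]) (m := c)).
  + rewrite -act_sigmaX; apply: Orbit_sum => //; first exact/act_rhoX_fixed.
    by move/(fixed_monomial wc)/eqP; rewrite (negbTE c_neq).
  + exact: leading_orbit_sum.
  + by rewrite def_t; apply: lepm_trans c_m (lem_addl _ _).
Qed.

End Order.

Lemma dihedral_universal_groebner :
  universal_groebner_basis (hilbert_ideal act) basis.
Proof.
move=> le le_order; split=> [||f]; first exact: basis_finite.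
  exact: basis_hilbert.
split; apply: in_ideal_incl => _ [g [m [g_in g_m ->]]]; last first.
  exact: hilbert_leading g_m.
by apply: in_ideal_gen; exists g, m; split=> //; apply: basis_hilbert.
Qed.

End Dihedral.

Theorem theorem6 (p r s : nat) (p_prime : prime p) (p_odd : odd p)
    (F : fieldType) (charF2 : 2%N \in [pchar F])
    (primF : exists zeta : F, p.-primitive_root zeta)
    (lambda : 'I_r -> F)
    (lambda_root : forall i, lambda i ^+ p = 1)
    (lambda_neq1 : forall i, lambda i != 1)
    (sigma rho : 'D_(2 * p))
    (sigma_order : #[sigma]%g = 2%N) (rho_order : #[rho]%g = p)
    (gen : <<[set sigma; rho]>>%g = [set: 'D_(2 * p)])
    (act : 'D_(2 * p) -> {lrmorphism {mpoly F[nvars r s]} -> {mpoly F[nvars r s]}})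
    (act_graded : graded_action act)
    (act_vars : dihedral_on_variables lambda sigma rho act) :
  universal_groebner_basis (hilbert_ideal act) (dihedral_basis p sigma rho act).
Proof.
exact (dihedral_universal_groebner charF2 (prime_gt0 p_prime) lambda_root gen
         act_graded act_vars).
Qed.
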